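(* (a) For every coloring $c:[\omega_2]^2\rightarrow\omega$ there exist a sequence $(\beta_n:n\in\omega)$ of pairwise distinct ordinals below $\omega_2$ and a color $\gamma\in\omega$ such that $c(\{\beta_n,\beta_{n+1}\})=\gamma$ for every $n\in\omega$ (i.e. $\omega_2\rightarrow_{\rm path}(\omega)^2_\omega$). (b) If $\kappa\le 2^{\omega}$ is a cardinal, then there is a coloring $c$ of the ordered pairs $(\alpha,\beta)$ of distinct elements of $\kappa$ with countably many colors such that there is no sequence $(\beta_n:n\in\omega)$ of pairwise distinct elements of $\kappa$ with $c(\beta_n,\beta_{n+1})$ constant in $n$. (c) For every coloring $c$ of the ordered pairs $(\alpha,\beta)$ of distinct elements of $\omega_2$ into $\omega$, there is a sequence $(\beta_n:n\in\omega)$ of pairwise distinct elements of $\omega_2$ such that $|\{c(\beta_n,\beta_{n+1}):n\in\omega\}|\le 2$.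
   Context: Paths here are ''simple'': the ordinals $\beta_n$ need to be pairwise distinct but not increasing. A coloring of ordered pairs may assign different colors to $(\alpha,\beta)$ and $(\beta,\alpha)$. *)

(* Defs.v *)
From mathcomp Require Import all_boot.
From mathcomp Require Import boolp classical_sets functions cardinality.
From mathcomp Require wochoice.

Set Implicit Arguments.
Unset Strict Implicit.
Unset Printing Implicit Defensive.

Local Open Scope classical_set_scope.
Local Open Scope card_scope.

(* An ordinal is represented by a type [T] with a (reflexive) well-order [R],
   whose elements stand for the smaller ordinals. *)

Definition segment (T : Type) (R : rel T) (x : T) : set T :=
  [set y | R y x /\ y <> x].

(* Initial ordinals: equinumerous to none of their elements. *)
Definition is_cardinal (T : Type) (R : rel T) : Prop :=
  wochoice.well_order R /\ forall x, ~ ([set: T] #= segment R x).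

(* [(T, R)] is the least ordinal that does not inject into [U], i.e. |U|^+. *)
Definition is_succ_cardinal (U T : Type) (R : rel T) : Prop :=
  [/\ wochoice.well_order R,
      ~ ([set: T] #<= [set: U]) &
      forall x, segment R x #<= [set: U]].

Definition is_omega1 (T : Type) (R : rel T) : Prop := is_succ_cardinal nat R.

Definition is_omega2 (T : Type) (R : rel T) : Prop :=
  exists (U : Type) (Q : rel U), is_omega1 Q /\ is_succ_cardinal U R.

Lemma is_succ_cardinal_is_cardinal (U T : Type) (R : rel T) :
  is_succ_cardinal U R -> is_cardinal R.
Proof.
move=> [woR nTU segU]; split=> // x /card_eqPle[TS _].
by apply: nTU; apply: card_le_trans TS (segU x).
Qed.

Lemma cantor (U : Type) : ~ ([set: set U] #<= [set: U]).
Proof.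
move=> /card_leP[f].
pose g (A : set U) : U := val (f (SigSub (mem_set (I : [set: set U] A)))).
have injg A B : g A = g B -> A = B.
  by move=> /val_inj/(inj (f := f)); rewrite !inE => /(_ I I)/(congr1 val).
pose D := [set x | exists2 A, g A = x & ~ A x].
have [DgD|nDgD] := pselect (D (g D)); last by apply: (nDgD); exists D.
by case: (DgD) => A /injg ->; apply.
Qed.

(* Hartogs; with it, statements over all [is_omega2 R] are not vacuous. *)
Lemma is_succ_cardinal_exists (U : Type) :
  exists (T : Type) (R : rel T), is_succ_cardinal U R.
Proof.
have [R woR] := wochoice.well_ordering_principle (set U).
pose S := [set x : set U | segment R x #<= [set: U]].
have antiR (x y : set U) : R x y && R y x -> x = y.
  have /wochoice.wo_chain_antisymmetric := wochoice.withinW (A := predT) woR.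
  by move=> /(_ x y isT isT).
exists S, (fun x y => R (val x) (val y)); split.
- move=> A [a Aa].
  have [|z [[/asboolP[x Ax xz] minz] _]] :=
      woR (fun y => `[< exists2 x : S, x \in A & val x = y >]).
    by exists (val a); apply/asboolP; exists a.
  have minx : wochoice.minimum_of (fun x y : S => R (val x) (val y)) A x.
    by split=> // y Ay; rewrite xz; apply: minz; apply/asboolP; exists y.
  exists x; split=> // y [Ay miny]; apply/val_inj/antiR.
  by rewrite miny// minx.2.
- rewrite (card_le_eql (card_setT S)) => SU.
  have [ST|nST] := pselect (forall x, S x).
    by apply: (@cantor U); apply: card_le_trans SU; apply: subset_card_le.
  have /existsNP[a nSa] := nST.
  have [|z [[/asboolP nSz minz] _]] := woR (fun x => `[< ~ S x >]).
    by exists a; apply/asboolP.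
  apply: nSz; apply: card_le_trans SU; apply: subset_card_le => y [Ryz yz].
  apply: contrapT => nSy; apply: yz; apply: antiR.
  by rewrite Ryz minz//; apply/asboolP.
- move=> x; have Sx : S (val x) by exact: set_valP.
  have injv : {in segment (fun x y : S => R (val x) (val y)) x &, injective val}.
    by move=> ? ? _ _; apply: val_inj.
  rewrite -(card_le_eql (inj_card_eq injv)).
  apply: card_le_trans Sx; apply: subset_card_le => _ [y [Ryx yx] <-].
  by split=> // /val_inj.
Qed.

Lemma is_omega2_exists : exists (T : Type) (R : rel T), is_omega2 R.
Proof.
have [U [Q o1Q]] := is_succ_cardinal_exists nat.
have [T [R sR]] := is_succ_cardinal_exists U.
by exists T, R, U, Q.
Qed.

(* Main.v *)
(* For (a), call A closed when, for a, b in A and every color g, the set of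
   common g-neighbours of a and b is contained in A as soon as it is countable.
   Some uncountable A <> omega_2 is closed: take the union of the closures of
   the countable sets [i v | v <= u], for i an injection of omega_1 into omega_2.
   If x is not in A, then P = [a in A | f a x = g] is uncountable for some g,
   and any two points of P have the common g-neighbour x outside A, hence
   uncountably many of them.  So from a sequence (a_n) in P one builds a path
   a_0, z_0, a_1, z_1, ... of color g.

   (c) is (a) for the coloring by the unordered pair of c(x, y) and c(y, x).
   For (b), color (X, Y) by a point n of their symmetric difference and by
   whether n is in X: no two consecutive pairs have the same color. *)

Require Import Defs.
From mathcomp Require Import all_boot.
From mathcomp Require Import boolp classical_sets functions cardinality.

Set Implicit Arguments.
Unset Strict Implicit.
Unset Printing Implicit Defensive.

Local Open Scope classical_set_scope.
Local Open Scope card_scope.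

(** * Well-orders and recursion along them *)

Section WellOrder.
Context {T : Type} {R : rel T} (woR : wochoice.well_order R).

Lemma wo_min (A : set T) : A !=set0 -> exists2 z, A z & forall y, A y -> R z y.
Proof.
move=> [a Aa]; have [|z [[/asboolP Az minz] _]] := @woR (fun y => `[< A y >]).
  by exists a; apply/asboolP.
by exists z => // y Ay; apply: minz; apply/asboolP.
Qed.

Lemma wo_total : total R.
Proof.
move=> x y; have [|z [->|->] minz] := @wo_min [set x; y]; first by exists x; left.
- by rewrite minz//; right.
- by rewrite orbC minz//; left.
Qed.

Lemma wo_refl : reflexive R.
Proof. by move=> x; have := wo_total x x; rewrite orbb. Qed.

Lemma wo_anti : antisymmetric R.
Proof.
move=> x y /andP[Rxy Ryx].
(* Here the uniqueness of minima, which [wo_min] forgets, is essential: [x] and [y] are both minima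
   of the pair. *)
have [|z [_ uz]] := @woR (fun z => `[< z = x \/ z = y >]).
  by exists x; apply/asboolP; left.
by rewrite -(uz x) ?(uz y)//; split; try (by apply/asboolP; tauto);
  move=> t /asboolP[|] ->//; apply: wo_refl.
Qed.

Lemma wo_trans : transitive R.
Proof.
move=> y x z Rxy Ryz.
have [|t txyz mint] := @wo_min [set u | u = x \/ u = y \/ u = z].
  by exists x; left.
case: txyz => [<-|[ty|tz]]; first by apply: mint; right; right.
- have -> : x = y by apply: wo_anti; rewrite Rxy -ty mint//; left.
  by [].
- have -> : z = y by apply: wo_anti; rewrite Ryz -tz mint//; right; left.
  by [].
Qed.

Lemma segment_wf : well_founded (fun y x => segment R x y).
Proof.
move=> a; apply: contrapT => nAcc.
have [|z nAz minz] := @wo_min [set x | ~ Acc (fun y x => segment R x y) x].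
  by exists a.
apply: nAz; constructor=> y [Ryz yz]; apply: contrapT => nAy.
by apply: yz; apply: wo_anti; rewrite Ryz minz.
Qed.

Lemma segment_total x y : x <> y -> segment R y x \/ segment R x y.
Proof.
by move=> xy; have /orP[] := wo_total x y => Rxy; [left|right]; split=> // /esym.
Qed.

End WellOrder.

(* By recursion, h w avoids the countably many values h y with y below w. *)
Lemma injective_choice (W V : Type) (lt : W -> W -> Prop) (D : W -> set V) :
  well_founded lt -> (forall x y, x <> y -> lt x y \/ lt y x) ->
  (forall w, countable [set y | lt y w]) -> (forall w, ~ countable (D w)) ->
  exists2 h : W -> V, injective h & forall w, D w (h w).
Proof.
move=> wf tot cnt ncnt.
have step w (h : forall y, lt y w -> V) :
    {v | D w v /\ forall y (yw : lt y w), h y yw <> v}.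
  apply: cid; apply: contrapT => noV; apply: (ncnt w).
  have sD : D w `<=` range (fun s : [set y | lt y w] => h (val s) (set_valP s)).
    move=> v Dv; apply: contrapT => nv; apply: noV; exists v; split=> // y yw hv.
    apply: nv; exists (SigSub (mem_set (yw : [set y | lt y w] y))) => //=.
    by rewrite -hv; congr h; apply: Prop_irrelevance.
  apply: sub_countable (subset_card_le sD) _.
  apply: sub_countable (card_image_le _ _) _.
  by apply: sub_countable (cnt w); rewrite (card_le_eql (card_setT _)).
pose h := Fix wf (fun=> V) (fun w h => sval (step w h)).
have hE w : h w = sval (step w (fun y _ => h y)).
  rewrite {1}/h Fix_eq// => x f g fg; congr (sval (step _ _)).
  by apply: functional_extensionality_dep => y; apply: funext => p.
have hP w : D w (h w) /\ forall y, lt y w -> h y <> h w.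
  by rewrite hE; case: (step w _).
exists h => [x y hxy|w]; last by have [] := hP w.
by apply: contrapT => /tot[] /(proj2 (hP _)); rewrite hxy.
Qed.

(* [T] is ordered lexicographically, by [r] then [R], so that its proper initial
   segments are countable. *)
Lemma card_le_countable_rank (U T : Type) (Q : rel U) (R : rel T) (r : T -> U) :
  wochoice.well_order Q -> wochoice.well_order R ->
  ~ countable [set: U] -> (forall u, countable [set t | Q (r t) u]) ->
  [set: T] #<= [set: U].
Proof.
move=> woQ woR ncU cr.
pose lt t' t := segment Q (r t) (r t') \/ r t' = r t /\ segment R t t'.
have wf : well_founded lt.
  move=> a; have [u] : exists u, u = r a by exists (r a).
  (* Nested induction: outer on the rank [u], inner on [R] among elements of rank [u]. *)
  elim/(well_founded_ind (segment_wf woQ)): u a => u IHu.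
  elim/(well_founded_ind (segment_wf woR)) => t IHt ut.
  constructor=> s [sr|[sr st]]; first by apply: IHu (erefl _); rewrite ut.
  by apply: IHt => //; rewrite ut.
have [|t|//|h hinj _] := @injective_choice T U lt (fun=> setT) wf.
- move=> x y xy; have [rxy|rxy] := pselect (r x = r y).
    by have [|] := segment_total woR xy; [left|right]; right.
  by have [|] := segment_total woQ rxy; [left|right]; left.
- apply: sub_countable (cr (r t)); apply: subset_card_le => s [[]//|[/= -> _]].
  exact: wo_refl.
rewrite -(card_le_eql (inj_card_eq (f := h) _)); last exact: in2W.
exact: subset_card_le.
Qed.

(** * Closure under countably many set-valued binary operations *)

Section Closure.
Context {T : Type} (F : T -> T -> nat -> set T).

Fixpoint closure_step (S : set T) (k : nat) : set T :=
  if k is k.+1 then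
    let S' := closure_step S k in
    S' `|` \bigcup_(p in (S' `*` S') `*` [set: nat]) F p.1.1 p.1.2 p.2
  else S.

Definition pair_closure (S : set T) : set T := \bigcup_k closure_step S k.

Lemma closure_step_le S i j : (i <= j)%N -> closure_step S i `<=` closure_step S j.
Proof.
by move=> /subnK <-; elim: (j - i)%N => //= k IHk x /IHk ?; left.
Qed.

Lemma closure_step_mono S S' k :
  S `<=` S' -> closure_step S k `<=` closure_step S' k.
Proof.
move=> SS'; elim: k => //= k IHk x [/IHk|[p [[/IHk ? /IHk ?] ?] Fx]]; first by left.
by right; exists p.
Qed.

Lemma pair_closureP S a b g :
  pair_closure S a -> pair_closure S b -> F a b g `<=` pair_closure S.
Proof.
(* Both points are present at stage [maxn i j]; [F a b g] enters one stage later. *)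
move=> [i _ Sa] [j _ Sb] x Fx; exists (maxn i j).+1 => //; right.
exists (a, b, g) => //; split=> //; split.
- by apply: closure_step_le Sa; apply: leq_maxl.
- by apply: closure_step_le Sb; apply: leq_maxr.
Qed.

Lemma countable_pair_closure S : (forall a b g, countable (F a b g)) ->
  countable S -> countable (pair_closure S).
Proof.
move=> cF cS; apply: bigcup_countable => // k _; elim: k => //= k IHk.
rewrite -bigcup2E; apply: bigcup_countable => // -[|[|n]] _ //=.
apply: bigcup_countable => //; apply: countableX => //; exact: countableX.
Qed.

End Closure.

Lemma uncountable_infinite T (A : set T) : ~ countable A -> infinite_set A.
Proof. by move=> ncA /finite_set_countable. Qed.

Lemma uncountable_setD T (A B : set T) :
  countable B -> ~ countable A -> ~ countable (A `\` B).
Proof.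
move=> cB ncA cAB; apply: ncA; apply: sub_countable (_ : countable (B `|` A `\` B)).
  by apply: subset_card_le => x Ax; have [|] := pselect (B x); [left|right].
by rewrite -bigcup2E; apply: bigcup_countable => // -[|[|n]] _.
Qed.

(** * Monochromatic paths for symmetric colorings *)

Section Paths.
Context {T : Type} (f : T -> T -> nat).
Hypothesis fC : forall x y, f x y = f y x.

Definition common_nbhd (g : nat) (a b : T) : set T :=
  [set x | f a x = g /\ f b x = g].

Lemma alternating_path (P : set T) (g : nat) :
  infinite_set P ->
  (forall a b, P a -> P b -> ~ countable (common_nbhd g a b)) ->
  exists2 beta : nat -> T, injective beta & forall n, f (beta n) (beta n.+1) = g.
Proof.
move=> /infiniteP/card_leP[a] ncP.
pose a' n : T := val (a (SigSub (mem_set (I : [set: nat] n)))).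
have a'inj : injective a'.
  by move=> m n /val_inj/(inj (f := a)); rewrite !inE => /(_ I I)/(congr1 val).
have Pa' n : P (a' n) by apply: set_valP.
(* Removing the countable range of [a'] keeps the connecting points [z n] distinct from every
   [a' m]. *)
have [|m n /eqP|n|n|z zinj zP] := @injective_choice nat T (fun m n => m < n)
  (fun n => common_nbhd g (a' n) (a' n.+1) `\` range a').
- by elim/ltn_ind => n IHn; constructor.
- by rewrite neq_ltn => /orP.
- exact: countableP.
- apply: uncountable_setD; last exact: ncP.
  by apply: sub_countable (card_image_le _ _) _; apply: countableP.
have zN m n : z m = a' n -> False.
  by move=> zma; have [_] := zP m; apply; exists n.
exists (fun n => if odd n then z n./2 else a' n./2) => [m n|n /=].
- case: ifP => om; case: ifP => on.
  + by move=> /zinj mn; rewrite -(odd_double_half m) -(odd_double_half n) om on mn.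
  + by move/zN.
  + by move=> /esym/zN.
  + by move=> /a'inj mn; rewrite -(odd_double_half m) -(odd_double_half n) om on mn.
(* With [k = n./2], the edge is [a' k], [z k] for even [n] and [z k], [a' k.+1] for odd [n];
   symmetry of [f] settles the mismatched order. *)
- rewrite uphalf_half; have [[az bz] _] := zP n./2.
  by case: (odd n) => /=; rewrite ?add1n ?add0n// fC.
Qed.

Lemma omega2_path (R : rel T) : is_omega2 R ->
  exists2 beta : nat -> T, injective beta &
    exists g, forall n, f (beta n) (beta n.+1) = g.
Proof.
move=> [U [Q [[woQ ncU segQ] [woR nTU _]]]].
have ncT : ~ countable [set: T].
  move=> cT; apply: nTU; apply: card_le_trans cT _.
  by apply/infiniteP/uncountable_infinite.
have cQ u : countable [set v | Q v u].
  rewrite (_ : [set v | Q v u] = [set v | Q v u] `&` [set u] `|` segment Q u).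
    rewrite -bigcup2E; apply: bigcup_countable => // -[|[|n]] _ //=.
    - exact: sub_countable (subset_card_le (@subIsetr _ _ _)) (countable1 u).
    - exact: segQ.
  apply/seteqP; split=> v /=.
    move=> Qvu; have [->|] := pselect (v = u); last by right.
    by left; split=> //; apply: wo_refl.
  by move=> [[]|[]].
have [i iinj _] : exists2 i : U -> T, injective i & forall u, [set: T] (i u).
  exact: injective_choice (segment_wf woQ) (segment_total woQ) segQ (fun=> ncT).
(* Uncountable neighbourhoods are replaced by the empty set, so that closures of countable sets stay
   countable. *)
pose F a b g :=
  if `[< countable (common_nbhd g a b) >] then common_nbhd g a b else set0.
have cF a b g : countable (F a b g) by rewrite /F; case: asboolP.
pose C u := pair_closure F [set i v | v in [set v | Q v u]].
have cC u : countable (C u).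
  apply: countable_pair_closure => //.
  by apply: sub_countable (card_image_le _ _) _; apply: cQ.
have CS u v : Q u v -> C u `<=` C v.
  move=> Quv x [k _ Cx]; exists k => //; apply: closure_step_mono Cx.
  by move=> _ [w Qwu <-]; exists w => //; apply: (wo_trans woQ) Quv.
have Ci u : C u (i u).
  by exists 0 => //; exists u => //; apply: wo_refl.
pose A := \bigcup_u C u.
(* Otherwise let [r t] be an index with [t] in [C (r t)]. Each [[set t | Q (r t) u]] then lies in
   the countable [C u], and omega_2 would inject into omega_1. *)
have [x nAx] : exists x, ~ A x.
  apply: contrapT => /forallNP allA.
  have /choice[r Cr] (t : T) : exists u, C u t.
    by have /contrapT[u _ Cut] := allA t; exists u.
  apply: nTU; apply: (card_le_countable_rank (r := r) woQ woR ncU) => u.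
  by apply: sub_countable (cC u); apply: subset_card_le => t /CS; apply.
pose P g := A `&` [set a | f a x = g].
(* [A] contains the uncountable range of [i], and there are only countably many colors. *)
have [g ncP] : exists g, ~ countable (P g).
  apply: contrapT => /forallNP cP; apply: ncU.
  rewrite -(card_le_eql (inj_card_eq (f := i) _)); last exact: in2W.
  apply: (@sub_countable _ _ _ (\bigcup_g P g)).
    apply: subset_card_le => _ [u _ <-].
    by exists (f (i u) x) => //; split=> //; exists u.
  by apply: bigcup_countable => // g _; apply: contrapT.
have [|a b [[u _ Cua] fa] [[v _ Cvb] fb] cN|beta] := @alternating_path (P g) g.
- exact: uncountable_infinite.
(* Were the common neighbourhood countable, it would equal [F a b g], and closure would put [x] into
   [A]. *)
- apply: nAx.
  have [w Cwa Cwb] : exists2 w, C w a & C w b.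
    have /orP[Quv|Qvu] := wo_total woQ u v.
      by exists v => //; apply: CS Cua.
    by exists u => //; apply: CS Cvb.
  exists w => //; apply: (pair_closureP Cwa Cwb (g := g)).
  by rewrite /F; case: asboolP.
by exists beta => //; exists g.
Qed.

End Paths.

Theorem theorem3p2 :
  (forall (T : Type) (R : rel T), is_omega2 R ->
     forall c : set T -> nat,
     exists (beta : nat -> T) (gamma : nat),
       injective beta /\ forall n, c [set beta n; beta n.+1] = gamma)
  /\
  (forall (K : Type) (R : rel K), is_cardinal R ->
     [set: K] #<= [set: set nat] ->
     exists c : K -> K -> nat,
       ~ exists (beta : nat -> K),
           injective beta /\
           exists gamma, forall n, c (beta n) (beta n.+1) = gamma)
  /\
  (forall (T : Type) (R : rel T), is_omega2 R ->
     forall c : T -> T -> nat,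
     exists beta : nat -> T,
       injective beta /\
       range (fun n => c (beta n) (beta n.+1)) #<= `I_2).
Proof.
split; [|split].
- move=> T R o2R c.
  have [|beta binj [g bg]] := @omega2_path T (fun x y => c [set x; y]) _ R o2R.
    by move=> x y; rewrite setUC.
  by exists beta, g.
- move=> K R _ /card_leP[h].
  pose h' k : set nat := val (h (SigSub (mem_set (I : [set: K] k)))).
  have h'inj : injective h'.
    by move=> m n /val_inj/(inj (f := h)); rewrite !inE => /(_ I I)/(congr1 val).
  have /choice[d dP] (p : K * K) :
      exists n, p.1 <> p.2 -> (h' p.1 n <-> ~ h' p.2 n).
    apply: contrapT => /forallNP nd; have /not_implyP[ne _] := nd 0.
    apply: ne; apply: h'inj; apply/seteqP.
    split=> n hn; apply: contrapT => nhn; apply: (nd n) => _; tauto.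
  exists (fun x y => pickle (d (x, y), `[< h' x (d (x, y)) >])).
  move=> [beta [binj [g bg]]].
  have bneq n : beta n <> beta n.+1 by move=> /binj/eqP; rewrite ltn_eqF.
  (* Equal colors on the first two edges give the same point [d] and the same membership bit for
     [beta 0] and [beta 1], which [d] was chosen to separate. *)
  have /(pcan_inj pickleK)[d01 h01] := etrans (bg 0) (esym (bg 1)).
  have /= := dP (beta 0, beta 1) (bneq 0).
  by move: h01; rewrite -d01; do 2 case: asboolP => ? //; tauto.
- move=> T R o2R c.
  have [|beta binj [g bg]] := @omega2_path T
    (* The minimum and maximum encode the unordered pair of the two colors, which makes the coloring
       symmetric. *)
    (fun x y => pickle (minn (c x y) (c y x), maxn (c x y) (c y x))) _ R o2R.
    by move=> x y; rewrite minnC maxnC.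
  exists beta; split=> //.
  pose m := minn (c (beta 0) (beta 1)) (c (beta 1) (beta 0)).
  pose M := maxn (c (beta 0) (beta 1)) (c (beta 1) (beta 0)).
  have bm n : c (beta n) (beta n.+1) = m \/ c (beta n) (beta n.+1) = M.
    have /(pcan_inj pickleK)[m0 M0] := etrans (bg n) (esym (bg 0)).
    by rewrite /m /M -m0 -M0; case: leqP; [left|right].
  apply: (@card_le_trans _ _ _ [set m; M]).
    by apply: subset_card_le => _ [n _ <-]; apply: bm.
  have -> : [set m; M] = (fun i => if i == 0 then m else M) @` `I_2.
    apply/seteqP; split=> [_ [->|->]|_ [[|i] _ <-]]; by
      [exists 0|exists 1|left|right].
  exact: card_image_le.
Qed.
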